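(* Let starting values $(V_0\otimes U_0)s_0$ be given, where $U_0,V_0$ have $r$ orthonormal columns and $s_0\in\mathbb R^{r^2}$. Let $u_1=(V_1\otimes U_1)s_1$ be the result of one step of the Euler-discretized splitting scheme (E1)–(E3) described in the context, and let $y_1$ be the result of a single step ($j=0$) of the alternating least squares iteration (L1)–(L2) described in the context, started from $y_0=(V_0\otimes U_0)s_0$. Then $u_1=y_1$.
   Context: Let $\Omega=(0,1)^2$ and let $A(t):H^1_0(\Omega)\to H^{-1}(\Omega)$ be the operator induced by the bilinear form $a(u,v;t)=\sum_{i,j=1}^2\alpha_{ij}(t)\int_\Omega\partial_iu\,\partial_jv\,\mathrm dx$, where $\alpha(t)=(\alpha_{ij}(t))$ is a symmetric, uniformly bounded and uniformly positive definite $2\times2$ matrix; let $f(t)$ be a given right-hand side. Let $(\varphi_n)_{n\in\mathcal I}$, $\mathcal I\subseteq\mathbb N$, be an orthonormal system in $L_2(0,1)$ of sufficiently regular functions, and put $$\tilde A(t)=\bigl(\langle A(t)(\varphi_{j_1}\otimes\varphi_{j_2}),\varphi_{i_1}\otimes\varphi_{i_2}\rangle\bigr)_{i,j\in\mathcal I^2},\qquad \tilde f(t)=\bigl(\langle f(t),\varphi_{i_1}\otimes\varphi_{i_2}\rangle\bigr)_{i\in\mathcal I^2}.$$ Let $h>0$ be the time step and $\tilde A_1=\tilde A(t_1)$, $\tilde f_1=\tilde f(t_1)$ at the new time point $t_1=t_0+h$. Rank-$r$ matrices $Y=USV^T$ ($U,V\in\mathbb R^{\mathcal I\times r}$ with orthonormal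 columns, $S\in\mathbb R^{r\times r}$) are written in vectorized form $\operatorname{vec}(Y)=(V\otimes U)s$, $s=\operatorname{vec}(S)$; $I$ denotes an identity matrix of the appropriate size. **Splitting scheme with Euler steps.** Given $U_0,V_0,s_0$: (E1) Solve $(V_0\otimes I)k_1+h(V_0V_0^T\otimes I)\tilde A_1(V_0\otimes I)k_1=(V_0\otimes U_0)s_0+h(V_0V_0^T\otimes I)\tilde f_1$ for $k_1$, and factorize $k_1=(I\otimes U_1)s_1^+$ such that $U_1$ has orthonormal columns. (E2) Set $s_0^+=s_1^++h(V_0^T\otimes U_1^T)\tilde A_1(V_0\otimes U_1)s_1^+-h(V_0^T\otimes U_1^T)\tilde f_1$. (E3) Solve $(I\otimes U_1)\ell_1+h(I\otimes U_1U_1^T)\tilde A_1(I\otimes U_1)\ell_1=(V_0\otimes U_1)s_0^++h(I\otimes U_1U_1^T)\tilde f_1$ for $\ell_1$, and factorize $\ell_1=(V_1\otimes I)s_1$ such that $V_1$ has orthonormal columns. The result is $u_1=(V_1\otimes U_1)s_1$. **Alternating least squares (ALS), first step ($j=0$)** for the problem of minimizing $\frac1{2h}\|y-u_0\|^2_{\ell_2}+\frac12\langle\tilde A_1y,y\rangle-\langle\tilde f_1,y\rangle$ over $y$ of rank $r$, with $u_0=y_0=(V_0\otimes U_0)s_0$: (L1) Solve $\bigl(I+h(V_0^T\otimes I)\tilde A_1(V_0\otimes I)\bigr)k_1=(I\otimes U_0)s_0+h(V_0^T\otimes I)\tilde f_1$ for $k_1$, then factorize $k_1=(I\otimes U_1)s_1^+$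 with $U_1$ having orthonormal columns. (L2) Solve $\bigl(I+h(I\otimes U_1^T)\tilde A_1(I\otimes U_1)\bigr)\ell_1=(V_0\otimes U_1^TU_0)s_0+h(I\otimes U_1^T)\tilde f_1$ for $\ell_1$, factorize $\ell_1=(V_1\otimes I)s_1$ with $V_1$ having orthonormal columns, and set $y_1=(V_1\otimes U_1)s_1$. The same deterministic procedure (e.g. QR decomposition) is used for the orthonormal factorizations in both schemes. *)

(* Defs.v *)
From HB Require Import structures.
From mathcomp Require Import all_boot all_order all_algebra.
From mathcomp Require Import finmap.
From mathcomp Require Import all_classical all_reals all_analysis.
From mathcomp.analysis.showcase Require summability.

Set Implicit Arguments.
Unset Strict Implicit.
Unset Printing Implicit Defensive.

Import Order.TTheory GRing.Theory Num.Theory.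
Import numFieldNormedType.Exports.

Local Open Scope classical_set_scope.
Local Open Scope ring_scope.

(* A Sobolev function is represented by its graph (u, (d_0 u, ..., d_(n-1) u)):
   a representative of the function together with representatives of its weak
   partial derivatives. *)
Definition sobolev (R : realType) (T : Type) (n : nat) : Type :=
  ((T -> R^o) * ('I_n -> T -> R^o))%type.

Section Sobolev.
Context {R : realType} {d : measure_display} {T : measurableType d}.
Context (mu : {measure set T -> \bar R}) (Omega : set T) {n : nat}.

Definition square_integrable (f : T -> R) : Prop :=
  measurable_fun Omega f /\ (\int[mu]_(x in Omega) ((f x) ^+ 2)%:E < +oo)%E.

Definition H1norm2 (u : (T -> R^o) * ('I_n -> T -> R^o)) : \bar R :=
  (\int[mu]_(x in Omega) ((u.1 x) ^+ 2)%:E +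
   \sum_(i < n) \int[mu]_(x in Omega) ((u.2 i x) ^+ 2)%:E)%E.

(* Closure, in the H^1(Omega) norm, of a set of graphs of test functions. *)
Definition H1closure (tests : set (sobolev R T n)) :
    set ((T -> R^o) * ('I_n -> T -> R^o)) :=
  [set u | [/\ square_integrable u.1, (forall i, square_integrable (u.2 i)) &
     exists psi : nat -> (T -> R^o) * ('I_n -> T -> R^o),
       (forall m, tests (psi m)) /\
       H1norm2 (psi m - u) @[m --> \oo] --> 0%E]].

End Sobolev.

Section TestFunctions.
Context {R : realType} {V : normedModType R} {n : nat}.
Context (e : 'I_n -> V) (Omega : set V).

(* All iterated partial derivatives along the directions e_i exist and are
   continuous. *)
Definition smooth (psi : V -> R^o) : Prop :=
  forall s : seq 'I_n,
    let g := foldr (fun i g => 'D_(e i) g) psi s in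
    continuous g /\ forall x i, derivable g x (e i).

Definition test_graph : set (sobolev R V n) :=
  [set u | [/\ smooth u.1,
     (exists K, [/\ compact K, K `<=` Omega & forall x, ~ K x -> u.1 x = 0]) &
     forall i, u.2 i = 'D_(e i) u.1]].

End TestFunctions.

Section Domain.
Context (R : realType).

Definition unit_itv : set R := `]0, 1[.
Definition unit_square : set (R * R) := unit_itv `*` unit_itv.

Definition plane_measure :
    {measure set (measurableTypeR R * measurableTypeR R) -> \bar R} :=
  (@lebesgue_measure R \x @lebesgue_measure R)%E.

Definition plane_dir (i : 'I_2) : R^o * R^o :=
  if i == 0 then (1, 0) else (0, 1).

Definition H10_itv : set (sobolev R R 1) :=
  H1closure (@lebesgue_measure R) unit_itv
    (test_graph (V := R^o) (fun=> 1) unit_itv).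

Definition H10_square : set (sobolev R (R * R) 2) :=
  H1closure plane_measure unit_square
    (test_graph (V := (R^o * R^o)%type) plane_dir unit_square).

(* H^{-1}(Omega), the dual of H^1_0(Omega); boundedness makes f independent of
   the representatives chosen in the graph. *)
Definition Hm1_square (f : (R * R -> R^o) * ('I_2 -> R * R -> R^o) -> R) : Prop :=
  (forall c u v, H10_square u -> H10_square v ->
     f (c *: u + v) = c * f u + f v) /\
  exists C : R, forall u, H10_square u ->
    `|f u| <= C * Num.sqrt (fine (H1norm2 plane_measure unit_square u)).

(* <A u, v> = a(u, v) *)
Definition elliptic_form (alpha : 'M[R]_2) (u v : sobolev R (R * R) 2) : R :=
  \sum_i \sum_j alpha i j *
    \int[plane_measure]_(x in unit_square) (u.2 i x * v.2 j x).

Definition tensor (p q : sobolev R R 1) : sobolev R (R * R) 2 :=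
  (fun x => p.1 x.1 * q.1 x.2,
   fun i x => if i == 0 then p.2 0 x.1 * q.1 x.2 else p.1 x.1 * q.2 0 x.2).

Definition symmetric_coef (D : set R) (alpha : R -> 'M[R]_2) : Prop :=
  forall t, D t -> (alpha t)^T = alpha t.

Definition uniformly_bounded_coef (D : set R) (alpha : R -> 'M[R]_2) : Prop :=
  exists C : R, forall t i j, D t -> `|alpha t i j| <= C.

Definition uniformly_posdef_coef (D : set R) (alpha : R -> 'M[R]_2) : Prop :=
  exists2 c : R, 0 < c & forall t (xi : 'cV[R]_2), D t ->
    c * (xi^T *m xi) 0 0 <= (xi^T *m alpha t *m xi) 0 0.

End Domain.

Arguments unit_itv R : clear implicits.
Arguments unit_square R : clear implicits.
Arguments plane_measure R : clear implicits.

(* The index set of the basis may be infinite, so matrices are functions of two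
   indices and sums are unconditional: limits along the finite subsets of the
   index set. On a finite index set these are ordinary finite sums and every
   convergence condition below is void. *)
Section Matrices.
Context {R : realType}.
Implicit Types I J K L : choiceType.

Definition has_sum J (x : J -> R) (s : R) : Prop :=
  summability.partial_sum x F @[F --> summability.totally] --> s.

Definition mulmv I J (M : I -> J -> R) (x : J -> R^o) : I -> R^o :=
  fun i => summability.sum (fun j => M i j * x j : R^o).

Definition mulmm I J K (M : I -> J -> R) (N : J -> K -> R) : I -> K -> R :=
  fun i k => summability.sum (fun j => M i j * N j k : R^o).

(* The series defining the entries of M x converge. *)
Definition mulmv_cvg I J (M : I -> J -> R) (x : J -> R^o) : Prop :=
  forall i, exists s, has_sum (fun j => M i j * x j) s.

Definition idmat J : J -> J -> R := fun i j => (i == j)%:R.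

Definition trmat I J (M : I -> J -> R) : J -> I -> R := fun j i => M i j.

(* vec stacks columns, so that vec (U S V^T) = (V (x) U) vec S; the entry of
   vec Y at position (i1, i2) is Y i1 i2, hence U acts on the first index. *)
Definition kron I J K L (V : I -> J -> R) (U : K -> L -> R) :
    K * I -> L * J -> R :=
  fun i j => U i.1 j.1 * V i.2 j.2.

Definition orthonormal_columns I J (U : I -> J -> R) : Prop :=
  forall k l, has_sum (fun i => U i k * U i l) (k == l)%:R.

End Matrices.

Arguments idmat {R J}.

Declare Scope infmat_scope.
Delimit Scope infmat_scope with IM.
Infix "*v" := mulmv (at level 41, right associativity) : infmat_scope.
Infix "*mm" := mulmm (at level 40, left associativity) : infmat_scope.
Infix "\ox" := kron (at level 40, left associativity) : infmat_scope.
Notation "M ^T" := (trmat M) : infmat_scope.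

Section Schemes.
Context {R : realType} {I : choiceType} {r : nat}.

Local Open Scope infmat_scope.

(* domA is the domain of the (possibly unbounded) infinite matrix A. *)
Context (domA : (I * I -> R^o) -> Prop) (A : I * I -> I * I -> R).
Context (f : I * I -> R^o) (h : R).

(* Factorization procedures for k = (I \ox U) s and l = (V \ox I) s. *)
Context (factU : (I * 'I_r -> R^o) ->
                 (I -> 'I_r -> R) * ('I_r * 'I_r -> R^o)).
Context (factV : ('I_r * I -> R^o) ->
                 (I -> 'I_r -> R) * ('I_r * 'I_r -> R^o)).

Definition factorizesU (k : I * 'I_r -> R^o) (U : I -> 'I_r -> R)
    (s : 'I_r * 'I_r -> R^o) : Prop :=
  [/\ factU k = (U, s), k = (idmat \ox U) *v s & orthonormal_columns U].

Definition factorizesV (l : 'I_r * I -> R^o) (V : I -> 'I_r -> R)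
    (s : 'I_r * 'I_r -> R^o) : Prop :=
  [/\ factV l = (V, s), l = (V \ox idmat) *v s & orthonormal_columns V].

(* B A y and B f are meaningful: y lies in the domain of A and all series
   converge. *)
Definition well_defined (K : choiceType) (B : K -> I * I -> R)
    (y : I * I -> R^o) : Prop :=
  [/\ domA y, mulmv_cvg A y, mulmv_cvg B (A *v y) & mulmv_cvg B f].

Definition splitting_K (U0 V0 : I -> 'I_r -> R) (s0 : 'I_r * 'I_r -> R^o)
    (k1 : I * 'I_r -> R^o) : Prop :=
  let P := (V0 *mm V0^T) \ox idmat in
  well_defined P ((V0 \ox idmat) *v k1) /\
  ((V0 \ox idmat) *v k1) + h *: (P *v A *v (V0 \ox idmat) *v k1) =
  ((V0 \ox U0) *v s0) + h *: (P *v f).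

Definition splitting_S (U1 V0 : I -> 'I_r -> R)
    (s1p s0p : 'I_r * 'I_r -> R^o) : Prop :=
  let B := V0^T \ox U1^T in
  well_defined B ((V0 \ox U1) *v s1p) /\
  s0p = s1p + h *: (B *v A *v (V0 \ox U1) *v s1p) - h *: (B *v f).

Definition splitting_L (U1 V0 : I -> 'I_r -> R) (s0p : 'I_r * 'I_r -> R^o)
    (l1 : 'I_r * I -> R^o) : Prop :=
  let P := idmat \ox (U1 *mm U1^T) in
  well_defined P ((idmat \ox U1) *v l1) /\
  ((idmat \ox U1) *v l1) + h *: (P *v A *v (idmat \ox U1) *v l1) =
  ((V0 \ox U1) *v s0p) + h *: (P *v f).

Definition splitting_step (U0 V0 : I -> 'I_r -> R) (s0 : 'I_r * 'I_r -> R^o)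
    (u1 : I * I -> R^o) : Prop :=
  exists k1 U1 s1p s0p l1 V1 s1,
    [/\ splitting_K U0 V0 s0 k1 /\ factorizesU k1 U1 s1p,
        splitting_S U1 V0 s1p s0p,
        splitting_L U1 V0 s0p l1 /\ factorizesV l1 V1 s1 &
        u1 = (V1 \ox U1) *v s1].

Definition als_K (U0 V0 : I -> 'I_r -> R) (s0 : 'I_r * 'I_r -> R^o)
    (k1 : I * 'I_r -> R^o) : Prop :=
  let B := V0^T \ox idmat in
  well_defined B ((V0 \ox idmat) *v k1) /\
  k1 + h *: (B *v A *v (V0 \ox idmat) *v k1) =
  ((idmat \ox U0) *v s0) + h *: (B *v f).

Definition als_L (U0 U1 V0 : I -> 'I_r -> R) (s0 : 'I_r * 'I_r -> R^o)
    (l1 : 'I_r * I -> R^o) : Prop :=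
  let B := idmat \ox U1^T in
  well_defined B ((idmat \ox U1) *v l1) /\
  l1 + h *: (B *v A *v (idmat \ox U1) *v l1) =
  ((V0 \ox (U1^T *mm U0)) *v s0) + h *: (B *v f).

Definition als_step (U0 V0 : I -> 'I_r -> R) (s0 : 'I_r * 'I_r -> R^o)
    (y1 : I * I -> R^o) : Prop :=
  exists k1 U1 s1p l1 V1 s1,
    [/\ als_K U0 V0 s0 k1 /\ factorizesU k1 U1 s1p,
        als_L U0 U1 V0 s0 l1 /\ factorizesV l1 V1 s1 &
        y1 = (V1 \ox U1) *v s1].

End Schemes.

Section Galerkin.
Context {R : realType} {I : choiceType} (phi : I -> sobolev R R 1).

Definition orthonormal_system : Prop :=
  forall m n : I,
    \int[@lebesgue_measure R]_(x in unit_itv R) ((phi m).1 x * (phi n).1 x) =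
    (m == n)%:R.

Definition product_basis (i : I * I) : (R * R -> R^o) * ('I_2 -> R * R -> R^o) :=
  tensor (phi i.1) (phi i.2).

Definition stiffness (alpha : 'M[R]_2) : I * I -> I * I -> R :=
  fun i j => elliptic_form alpha (product_basis j) (product_basis i).

Definition load (f : sobolev R (R * R) 2 -> R) : I * I -> R^o :=
  fun i => f (product_basis i).

(* The stiffness matrix represents an operator on H^1_0, so it acts on the
   coefficient vectors y whose expansion sum_i y_i phi_i1 (x) phi_i2 converges
   in H^1_0(Omega); for finite I these are all vectors. *)
Definition energy_domain (y : I * I -> R^o) : Prop :=
  exists u : (R * R -> R^o) * ('I_2 -> R * R -> R^o), H10_square u /\
    H1norm2 (plane_measure R) (unit_square R)
      (summability.partial_sum (fun i => y i *: product_basis i) F - u)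
      @[F --> summability.totally] --> 0%E.

End Galerkin.

(* Main.v *)
(** Multiplying (E1) by V_0^T (x) I gives (L1). Likewise (E3) multiplied by
    I (x) U_1^T gives (L2), because (L1) multiplied by I (x) U_1^T turns the
    backward step (E2) into s_0^+ = (I (x) U_1^T U_0) s_0. Equality of the two
    results then follows from unique solvability of (L1) and (L2), which holds
    since the energy form is nonnegative.

    Over an infinite index set the products with V_0^T are series whose
    convergence is not granted by that of the series with V_0 V_0^T; it follows
    because finitely many rows of V_0 already span R^r. The associativity laws
    become Fubini for unconditional sums, and nonnegativity of <y, A y> is
    obtained as the limit a(u, u) of the expansions of u in H^1. *)
Require Import Defs.
From mathcomp Require Import all_boot all_order all_algebra.
From mathcomp Require Import finmap ring lra.
From mathcomp Require Import all_classical all_reals all_analysis.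
From mathcomp Require Import measurable_realfun.
From mathcomp.analysis.showcase Require summability.

Set Implicit Arguments.
Unset Strict Implicit.
Unset Printing Implicit Defensive.

Import Order.TTheory GRing.Theory Num.Theory.
Import numFieldNormedType.Exports.

Local Open Scope classical_set_scope.
Local Open Scope ring_scope.

(** * Unordered sums *)

#[local] Existing Instance summability.totally_filter.

Section UnorderedSums.
Context {R : realType}.
Implicit Types J K : choiceType.

Lemma partial_sumE J (V : zmodType) (x : J -> V) (A : {fset J}) :
  summability.partial_sum x A = \sum_(i <- A) x i.
Proof. exact/esym/big_seq_fsetE. Qed.

(** The epsilon form of convergence along finite subsets; reindexing and Fubini below are arguments
    about such sets. *)
Lemma has_sumP J (x : J -> R) (s : R) :
  has_sum x s <-> forall e : R, 0 < e -> exists A : {fset J},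
    forall B : {fset J}, (A `<=` B)%fset -> `|s - \sum_(i <- B) x i| < e.
Proof.
rewrite /has_sum; split => [/cvgrPdist_lt xs e e0|xs].
  have [A _ hA] := xs e e0; exists A => B AB.
  by have := hA B AB; rewrite /= partial_sumE.
apply/cvgrPdist_lt => e /xs[A hA]; exists A => // B AB /=.
by rewrite partial_sumE; exact: hA.
Qed.

Lemma has_sum_unique J (x : J -> R) (s t : R) :
  has_sum x s -> has_sum x t -> s = t.
Proof.
by move=> xs xt; apply: (cvg_unique _ xs xt).
Qed.

(** [summability.sum] is a [lim], meaningful only under convergence, so products of infinite
    matrices are always evaluated through a proof of [has_sum]. *)
Lemma has_sum_sum J (x : J -> R^o) (s : R) :
  has_sum x s -> summability.sum x = s.
Proof.
by move=> xs; apply: cvg_lim.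
Qed.

Lemma eq_has_sum J (x y : J -> R) s : x =1 y -> has_sum x s -> has_sum y s.
Proof. by move=> /funext ->. Qed.

Lemma has_sum0 J : has_sum (fun _ : J => 0 : R) 0.
Proof.
by apply/has_sumP => e e0; exists fset0 => B _; rewrite big1// subrr normr0.
Qed.

Lemma has_sumD J (x y : J -> R) s t :
  has_sum x s -> has_sum y t -> has_sum (fun j => x j + y j) (s + t).
Proof.
move=> xs yt; rewrite /has_sum.
rewrite (_ : summability.partial_sum (fun j => x j + y j) =
  summability.partial_sum x \+ summability.partial_sum y).
  exact: (cvgD xs yt).
by apply/funext => A /=; rewrite !partial_sumE big_split.
Qed.

Lemma has_sumZ J (x : J -> R) c s :
  has_sum x s -> has_sum (fun j => c * x j) (c * s).
Proof.
move=> xs; rewrite /has_sum.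
rewrite (_ : summability.partial_sum (fun j => c * x j) =
  (fun A => c * summability.partial_sum x A)).
  exact: (cvgM (cvg_cst c) xs).
by apply/funext => A /=; rewrite !partial_sumE mulr_sumr.
Qed.

Lemma has_sumB J (x y : J -> R) s t :
  has_sum x s -> has_sum y t -> has_sum (fun j => x j - y j) (s - t).
Proof.
move=> xs /(has_sumZ (c := -1)) yt; have := has_sumD xs yt; rewrite mulN1r.
by apply: eq_has_sum => j; rewrite mulN1r.
Qed.

Lemma has_sum_bigop J (K : Type) (r : seq K) (x : K -> J -> R) (s : K -> R) :
  (forall k, has_sum (x k) (s k)) ->
  has_sum (fun j => \sum_(k <- r) x k j) (\sum_(k <- r) s k).
Proof.
move=> xs; elim: r => [|k r ih].
  by rewrite big_nil; apply: eq_has_sum (has_sum0 J) => j; rewrite big_nil.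
rewrite big_cons; apply: eq_has_sum (has_sumD (xs k) ih) => j.
by rewrite big_cons.
Qed.

Lemma has_sum_fin (J : finType) (x : J -> R) : has_sum x (\sum_j x j).
Proof.
apply/has_sumP => e e0; exists [fset j in enum J]%fset => B JB.
suff -> : \sum_(i <- B) x i = \sum_j x j by rewrite subrr normr0.
rewrite -big_enum /=; apply: perm_big; apply: uniq_perm.
- exact: fset_uniq.
- exact: enum_uniq.
move=> j; rewrite mem_enum; have /fsubsetP/(_ j) := JB.
by rewrite !inE mem_enum => ->.
Qed.

(** The second hypothesis says that [x] vanishes off the image of [e]. Finite sets are moved forward
    by [e] and back by [g], and the surplus indices contribute zero. *)
Lemma has_sum_embed J K (e : J -> K) (g : K -> J) (x : K -> R) s :
  cancel e g -> (forall k, e (g k) != k -> x k = 0) ->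
  has_sum x s <-> has_sum (x \o e) s.
Proof.
move=> eK x0; have einj := can_inj eK.
have sume (B : {fset J}) :
    \sum_(k <- [fset e j | j in B]%fset) x k = \sum_(j <- B) x (e j).
  by rewrite big_imfset// => i j _ _ /einj.
split=> /has_sumP xs; apply/has_sumP => eps /xs[A hA].
  (* Indices of [A] missing from the image of [B] lie off the image of [e], so adding them does not
     change the sum. *)
  exists [fset g k | k in A]%fset => B AB.
  have -> : \sum_(j <- B) (x \o e) j =
      \sum_(k <- ([fset e j | j in B] `|` A)%fset) x k.
    rewrite -sume; apply: big_fset_incl; first exact: fsubsetUl.
    move=> k; rewrite inE => /orP[->//|kA] kB; apply: x0.
    apply: contra kB => /eqP <-; apply/imfsetP; exists (g k) => //=.
    by move/fsubsetP : AB; apply; apply/imfsetP; exists k.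
  by apply: hA; exact: fsubsetUr.
exists [fset e j | j in A]%fset => B AB.
(* [B'] pulls back the part of [B] in the image of [e]; the rest of [B] carries zeros. *)
pose B' := [fset g k | k in [fset k in B | e (g k) == k]]%fset.
have -> : \sum_(k <- B) x k = \sum_(j <- B') (x \o e) j.
  rewrite -sume; apply/esym/big_fset_incl.
    apply/fsubsetP => _ /imfsetP[_ /imfsetP[k /= kB ->] ->].
    by move: kB; rewrite !inE/= => /andP[kB /eqP ->].
  move=> k kB; apply: contraNeq => xk0; apply/imfsetP; exists (g k) => /=.
    apply/imfsetP; exists k => //=; rewrite !inE kB/=.
    by apply: contraNT xk0 => /x0 ->.
  by apply/eqP; rewrite eq_sym; apply: contraNT xk0 => /x0 ->.
apply: hA; apply/fsubsetP => j jA; apply/imfsetP; exists (e j) => /=.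
  rewrite !inE/= eK eqxx andbT; move/fsubsetP : AB; apply.
  by apply/imfsetP; exists j.
by rewrite eK.
Qed.

Lemma has_sum_swap J K (x : J * K -> R) s :
  has_sum x s <-> has_sum (fun p : K * J => x (p.2, p.1)) s.
Proof.
pose sw A B (p : A * B) : B * A := (p.2, p.1).
apply: (@has_sum_embed _ _ (sw K J) (sw J K)); first by case.
by case=> j k; rewrite eqxx.
Qed.

(** A finite set of rows containing the first projection of [A] is compared with a finite rectangle
    that approximates its row sums; each comparison costs e/2. *)
Lemma has_sum_fubini J K (x : J * K -> R) s (t : J -> R) :
  has_sum x s -> (forall j, has_sum (fun k => x (j, k)) (t j)) -> has_sum t s.
Proof.
move=> /has_sumP xs xt; apply/has_sumP => e e0.
have [A hA] := xs (e / 2) ltac:(by lra).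
exists [fset p.1 | p in A]%fset => B AB.
pose r : seq J := B.
have := has_sum_bigop (r := r) xt => /has_sumP/(_ (e / 2) ltac:(by lra))[C hC].
(* [D] is large enough for the rows in [B] and contains the second projection of [A], so the
   rectangle contains [A]. *)
pose D := (C `|` [fset p.2 | p in A])%fset.
have := hC D (fsubsetUl _ _); rewrite exchange_big/=.
have -> : \sum_(j <- r) \sum_(k <- D) x (j, k) =
    \sum_(p <- (B `*` D)%fset) x p.
  rewrite -big_allpairs.
  apply: perm_big; apply: uniq_perm; last 2 first.
  - exact: fset_uniq.
  - move=> [j k]; rewrite in_fsetM/=; apply/allpairsP/andP => [[[j' k'] /=]|].
      by move=> [? ? [-> ->]].
    by move=> [jB kD]; exists (j, k).
  by apply: allpairs_uniq; [exact: fset_uniq|exact: fset_uniq|case=> ? ? []].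
have /hA : (A `<=` B `*` D)%fset.
  apply/fsubsetP => p pA; rewrite in_fsetM inE; apply/andP; split.
    by move/fsubsetP : AB; apply; apply/imfsetP; exists p.
  by apply/orP; right; apply/imfsetP; exists p.
by move: (\sum_(p <- _) x p) => S; rewrite !ltr_norml; lra.
Qed.

Lemma le_has_sum J (x : J -> R) s : (forall j, 0 <= x j) -> has_sum x s ->
  forall j, x j <= s.
Proof.
move=> x0 /has_sumP xs j; rewrite leNgt; apply/negP => sx.
have [A hA] := xs (x j - s) ltac:(by lra).
have := hA (j |` A)%fset (fsubsetUr _ _).
rewrite (@big_fsetD1 _ _ _ _ j)/=; last by rewrite !inE eqxx.
have : 0 <= \sum_(i <- ((j |` A) `\ j)%fset) x i by apply: sumr_ge0.
move: (\sum_(i <- _) _) => S S0; rewrite ltr_norml; lra.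
Qed.

(** Comparison test by completeness: beyond [A], partial sums of [x] move by at most as much as
    those of [y]. *)
Lemma has_sum_domin J (x y : J -> R) s : (forall j, `|x j| <= y j) ->
  has_sum y s -> exists t, has_sum x t.
Proof.
move=> xy /has_sumP ys.
suff : cauchy (summability.partial_sum x @ summability.totally).
  by move=> /cauchy_cvgP;
    exists (lim (summability.partial_sum x @ summability.totally)).
apply: cauchy_exP => e e0.
have [A hA] := ys (e / 2) ltac:(by lra).
exists (\sum_(i <- A) x i), A => // B /= AB.
rewrite partial_sumE -ball_normE/=.
have dec (z : J -> R) : \sum_(i <- B) z i =
    \sum_(i <- A) z i + \sum_(i <- (B `\` A)%fset) z i.
  rewrite (big_fsetID _ (mem A)) /=; congr (_ + _); apply: eq_fbigl => j.
    rewrite !inE /= andbC; have /fsubsetP/(_ j) := AB.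
    by case: (j \in A) => // ->.
  by rewrite !inE /= andbC.
have := hA A (fsubset_refl _); have := hA B AB.
rewrite (dec y) => h1 h2; rewrite (dec x) opprD addrA subrr add0r normrN.
have xyD : `|\sum_(i <- (B `\` A)%fset) x i| <= \sum_(i <- (B `\` A)%fset) y i.
  by apply: le_trans (ler_norm_sum _ _ _) _; apply: ler_sum.
by apply: le_lt_trans xyD _; move: h1 h2; rewrite !ltr_norml; lra.
Qed.

End UnorderedSums.

(** * Matrices with orthonormal columns *)

Section OrthonormalColumns.
Context {R : realType} {I : choiceType} {r : nat} (V : I -> 'I_r -> R).
Hypothesis oV : orthonormal_columns V.

(** This is V^T (V x) = x; the sum over the r columns is finite and commutes with the series. *)
Lemma orthonormal_columns_coef (x : 'I_r -> R) l :
  has_sum (fun i => V i l * \sum_k V i k * x k) (x l).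
Proof.
have H k : has_sum (fun i => x k * (V i l * V i k)) (x k * (l == k)%:R).
  exact: has_sumZ (@oV l k).
have := has_sum_bigop (r := index_enum 'I_r) H.
rewrite (bigD1 l)//= eqxx mulr1 big1 ?addr0; last first.
  by move=> k /negPf; rewrite eq_sym => ->; rewrite mulr0.
apply: eq_has_sum => i; rewrite mulr_sumr; apply: eq_bigr => k _; ring.
Qed.

Lemma orthonormal_columns_inj (x : 'I_r -> R) :
  (forall i, \sum_k V i k * x k = 0) -> forall k, x k = 0.
Proof.
move=> x0 k; apply: (has_sum_unique (@orthonormal_columns_coef x k)).
by apply: eq_has_sum (has_sum0 _) => i; rewrite x0 mulr0.
Qed.

(* The Gram matrices of finite sets of rows converge to the identity, hence
   some of them is invertible. *)
Lemma orthonormal_columns_span :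
  exists (A : {fset I}) (C : 'I_r -> I -> R), forall j k,
    V j k = \sum_(i <- A) C k i * \sum_m V i m * V j m.
Proof.
pose G (A : {fset I}) : 'M[R]_r := \matrix_(k, l) \sum_(i <- A) V i k * V i l.
have cvgG k l : G A k l @[A --> summability.totally] --> (1%:M : 'M[R]_r) k l.
  have := @oV k l; rewrite /has_sum mxE; suff -> :
    (fun A => G A k l) = summability.partial_sum (fun i => V i k * V i l) by [].
  by apply/funext => A; rewrite partial_sumE mxE.
(* The determinant is a polynomial in the entries, so it tends to det 1 = 1; once within distance 1
   of its limit it is nonzero. *)
have cvgdet : \det (G A) @[A --> summability.totally] --> (1 : R).
  rewrite -(det1 R r) /determinant.
  apply: cvg_big => [|s _]; first exact: add_continuous.
  apply: cvgM; first exact: cvg_cst.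
  by apply: cvg_big => [|i _]; [exact: mul_continuous|exact: cvgG].
have /cvgrPdist_lt/(_ 1 ltr01)[A _ /(_ A)] := cvgdet.
rewrite /= => /(_ (fsubset_refl A)) dA.
have GA : G A \in unitmx.
  rewrite unitmxE unitfE; apply/eqP => d0.
  by move: dA; rewrite d0 subr0 normr1 ltxx.
(* G(A) times row j of V is the combination, over i in [A], of the rows V_i with weights V_i . V_j.
   Applying the inverse of G(A) gives the coefficients. *)
exists A, (fun k i => \sum_l invmx (G A) k l * V i l) => j k.
have -> : V j k = (invmx (G A) *m (G A *m \col_m V j m)) k 0.
  by rewrite mulKmx// mxE.
rewrite mxE; under [LHS]eq_bigr do rewrite mxE.
under [RHS]eq_bigr do rewrite mulr_suml.
rewrite [RHS]exchange_big/=; apply: eq_bigr => l _.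
rewrite mulr_sumr; under [LHS]eq_bigr do rewrite !mxE mulr_suml mulr_sumr.
rewrite exchange_big/=; apply: eq_bigr => i _.
by rewrite mulr_sumr; apply: eq_bigr => m _; ring.
Qed.

(** Finitely many rows of V V^T generate the columns of V, so each series of V^T w is a finite
    combination of series of V V^T w. *)
Lemma orthonormal_projection_summable (w : I -> R) :
  (forall i, exists s, has_sum (fun j => (\sum_m V i m * V j m) * w j) s) ->
  forall k, exists s, has_sum (fun j => V j k * w j) s.
Proof.
move=> /choice[s ws] k; have [A [C VE]] := orthonormal_columns_span.
pose rA : seq I := A.
have H i : has_sum (fun j => C k i * ((\sum_m V i m * V j m) * w j))
    (C k i * s i) by exact: has_sumZ.
exists (\sum_(i <- rA) C k i * s i).
apply: eq_has_sum (has_sum_bigop (r := rA) H) => j.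
by rewrite (VE j k) mulr_suml; apply: eq_bigr => i _; rewrite mulrA.
Qed.

Lemma has_sum_projection (w : I -> R) (t : 'I_r -> R) i :
  (forall k, has_sum (fun j => V j k * w j) (t k)) ->
  has_sum (fun j => (\sum_m V i m * V j m) * w j) (\sum_m V i m * t m).
Proof.
move=> wt; have H k : has_sum (fun j => V i k * (V j k * w j)) (V i k * t k).
  exact: has_sumZ.
apply: eq_has_sum (has_sum_bigop (r := index_enum 'I_r) H) => j.
by rewrite mulr_suml; apply: eq_bigr => m _; rewrite mulrA.
Qed.

(** Cancels V from V x + h V V^T w = V c + h V V^T g: once the series of V^T w and V^T g are known
    to converge, both sides are V times a vector, and V is injective. *)
Lemma orthonormal_projection_eq (h : R) (w g : I -> R) (x c : 'I_r -> R) :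
  (forall i, exists s t,
    [/\ has_sum (fun j => (\sum_m V i m * V j m) * w j) s,
        has_sum (fun j => (\sum_m V i m * V j m) * g j) t &
        \sum_k V i k * x k + h * s = \sum_k V i k * c k + h * t]) ->
  forall k, exists s t,
    [/\ has_sum (fun j => V j k * w j) s, has_sum (fun j => V j k * g j) t &
        x k + h * s = c k + h * t].
Proof.
move=> H.
have /choice[a wa] : forall k, exists s, has_sum (fun j => V j k * w j) s.
  by apply: orthonormal_projection_summable => i; have [s [t []]] := H i; exists s.
have /choice[b gb] : forall k, exists s, has_sum (fun j => V j k * g j) s.
  by apply: orthonormal_projection_summable => i; have [s [t []]] := H i; exists t.
move=> k; exists (a k), (b k); split => //; apply/eqP; rewrite -subr_eq0; apply/eqP.
apply: (@orthonormal_columns_inj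
  (fun k => x k + h * a k - (c k + h * b k))) => i.
have [s [t [ws gt]]] := H i.
rewrite (has_sum_unique ws (has_sum_projection (i := i) wa)).
rewrite (has_sum_unique gt (has_sum_projection (i := i) gb)) => /eqP.
rewrite -subr_eq0 !mulr_sumr -!big_split -sumrB => /eqP {2}<-.
by apply: eq_bigr => m _ /=; ring.
Qed.

(* By Fubini the pairing q >= 0 of y = (I (x) V) x with w equals - |x|^2 / h. *)
Lemma orthonormal_monotone_eq0 (J : choiceType) (h q : R)
    (x : J -> 'I_r -> R) (w : J * I -> R) :
  0 < h -> 0 <= q ->
  has_sum (fun p => (\sum_m V p.2 m * x p.1 m) * w p) q ->
  (forall j m, exists2 t, has_sum (fun i => V i m * w (j, i)) t &
    x j m + h * t = 0) ->
  forall j m, x j m = 0.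
Proof.
move=> h0 q0 yw xt.
(* In row j the pairing is x_j . (V^T w_j), and x_j = - h V^T w_j. *)
have rows j : has_sum (fun i => (\sum_m V i m * x j m) * w (j, i))
    (- h^-1 * \sum_m x j m ^+ 2).
  have H m : has_sum (fun i => x j m * (V i m * w (j, i)))
      (- h^-1 * x j m ^+ 2).
    have [t wt xE] := xt j m.
    have -> : - h^-1 * x j m ^+ 2 = x j m * t.
      have -> : x j m = - (h * t) by lra.
      by field; rewrite gt_eqF.
    exact: has_sumZ.
  rewrite mulr_sumr; apply: eq_has_sum (has_sum_bigop (r := index_enum 'I_r) H).
  by move=> i; rewrite mulr_suml; apply: eq_bigr => m _; ring.
(* After scaling by -h the terms are |x_j|^2 and their total is -h q <= 0, which bounds every
   square. *)
have := has_sum_fubini yw rows => /(has_sumZ (c := - h)).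
under [X in has_sum X]eq_fun do rewrite mulrA mulrNN divff ?gt_eqF// mul1r.
move=> /le_has_sum xq j m; apply/eqP; rewrite -sqrf_eq0 eq_le sqr_ge0 andbT.
apply: (@le_trans _ _ (- h * q)); last by rewrite mulNr oppr_le0 mulr_ge0// ltW.
apply: le_trans (xq _ j); last by move=> k; apply: sumr_ge0 => l _; exact: sqr_ge0.
by rewrite (bigD1 m)//= lerDl; apply: sumr_ge0 => l _; exact: sqr_ge0.
Qed.

End OrthonormalColumns.

(** * The two schemes for a monotone operator *)

Section KroneckerSums.
Context {R : realType} {I : choiceType} {r : nat}.
Local Open Scope infmat_scope.

Lemma mulmv_has_sum (J K : choiceType) (M : J -> K -> R) (x : K -> R^o) j s :
  has_sum (fun k => M j k * x k) s -> (M *v x) j = s.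
Proof. exact: has_sum_sum. Qed.

Lemma mulmv_cvg_has_sum (J K : choiceType) (M : J -> K -> R) (x : K -> R^o) :
  mulmv_cvg M x -> forall j, has_sum (fun k => M j k * x k) ((M *v x) j).
Proof. by move=> Mx j; have [s xs] := Mx j; rewrite (mulmv_has_sum xs). Qed.

(** The identity factor kills all entries outside the slice with first index [p.1]. As an
    equivalence, it also transfers convergence both ways. *)
Lemma has_sum_kron_idr (J K L : choiceType) (M : K -> L -> R) (w : J * L -> R)
    (p : J * K) s :
  has_sum (fun q => (M \ox idmat) p q * w q) s <->
  has_sum (fun l => M p.2 l * w (p.1, l)) s.
Proof.
rewrite (@has_sum_embed _ _ _ (pair p.1) snd) => [||q] //=.
  split; apply: eq_has_sum => l /=;
    by rewrite /kron /idmat/= eqxx mul1r.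
by case: q => a b /=; rewrite /kron /idmat/= xpair_eqE eqxx andbT => /negPf ->;
  rewrite !mul0r.
Qed.

Lemma has_sum_kron_idl (J K L : choiceType) (M : K -> L -> R) (w : L * J -> R)
    (p : K * J) s :
  has_sum (fun q => (idmat \ox M) p q * w q) s <->
  has_sum (fun l => M p.1 l * w (l, p.2)) s.
Proof.
rewrite has_sum_swap; have := has_sum_kron_idr M (fun q => w (q.2, q.1)) (p.2, p.1) s.
rewrite /=; move=> <-; split; apply: eq_has_sum => q;
  by rewrite /kron/= [M _ _ * _]mulrC.
Qed.

Lemma mulmv_kron_idr (K J : choiceType) (V : K -> 'I_r -> R) (x : J * 'I_r -> R^o) p :
  ((V \ox idmat) *v x) p = \sum_m V p.2 m * x (p.1, m).
Proof. by apply: mulmv_has_sum; apply/has_sum_kron_idr; exact: has_sum_fin. Qed.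

Lemma mulmv_kron_idl (K J : choiceType) (U : K -> 'I_r -> R) (x : 'I_r * J -> R^o) p :
  ((idmat \ox U) *v x) p = \sum_m U p.1 m * x (m, p.2).
Proof. by apply: mulmv_has_sum; apply/has_sum_kron_idl; exact: has_sum_fin. Qed.

Lemma mulmv_kron (J K : choiceType) (V : J -> 'I_r -> R) (U : K -> 'I_r -> R)
    (s : 'I_r * 'I_r -> R^o) p :
  ((V \ox U) *v s) p = \sum_m \sum_l U p.1 m * V p.2 l * s (m, l).
Proof.
rewrite pair_big; apply: mulmv_has_sum.
have := @has_sum_fin R ('I_r * 'I_r)%type
  (fun q => U p.1 q.1 * V p.2 q.2 * s (q.1, q.2)).
by apply: eq_has_sum => -[m l].
Qed.

Lemma mulmm_trmat (V : I -> 'I_r -> R) :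
  V *mm V^T = fun i j => \sum_m V i m * V j m.
Proof.
by apply/funext => i; apply/funext => j; apply: has_sum_sum; exact: has_sum_fin.
Qed.

(** Convergence by comparison: |ab| <= a^2 + b^2, and the squares of orthonormal columns are
    summable. *)
Lemma mulmm_has_sum (U W : I -> 'I_r -> R) k m :
  orthonormal_columns U -> orthonormal_columns W ->
  has_sum (fun i => U i k * W i m) ((U^T *mm W) k m).
Proof.
move=> oU oW; have oUW := has_sumD (@oU k k) (@oW m m).
have [i|t UW] := @has_sum_domin R I (fun i => U i k * W i m) _ _ _ oUW.
  have := sqr_ge0 (`|U i k| - `|W i m|).
  have := sqr_ge0 (U i k); have := sqr_ge0 (W i m).
  by rewrite sqrrB !real_normK ?num_real// normrM -!expr2; lra.
by rewrite /mulmm (has_sum_sum (x := fun i => trmat U k i * W i m) UW).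
Qed.

End KroneckerSums.

Arguments mulmv_cvg_has_sum {R J K M x} _ j.

Section ImplicitStep.
Context {R : realType} {T : Type} (h : R).
Implicit Types x b c d : T -> R^o.

Lemma implicit_stepE x b c d :
  x + h *: b = c + h *: d <-> forall p, x p + h * b p = c p + h * d p.
Proof.
split=> [E p|E]; last by apply/funext => p; exact: E.
exact: (congr1 (fun g => g p) E).
Qed.

Lemma implicit_step_sub x x' b b' c : x + h *: b = c -> x' + h *: b' = c ->
  forall p, x p - x' p + h * (b p - b' p) = 0.
Proof.
move=> <- E p; have := congr1 (fun g => g p) E.
rewrite /= !fctE /GRing.scale/=; move: (x p) (x' p) (b p) (b' p); clear.
by move=> a a' b b'; lra.
Qed.

End ImplicitStep.

(** * Uniqueness of the ALS solutions and reduction of the splitting scheme to ALS *)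

Section Schemes.
Context {R : realType} {I : choiceType} {r : nat}.
Local Open Scope infmat_scope.
Context (domA : (I * I -> R^o) -> Prop) (A : I * I -> I * I -> R).
Context (f : I * I -> R^o) (h : R).
Hypothesis h_gt0 : 0 < h.

(** Monotonicity as for nonlinear operators: A y - A y' stands in place of A (y - y'), which would
    require [domA] to be closed under subtraction. Convergence of the pairing is part of the
    property. *)
Definition monotone_on : Prop := forall y y' : I * I -> R^o,
  domA y -> domA y' -> exists2 q : R, 0 <= q &
  has_sum (fun p => (y p - y' p) * ((A *v y) p - (A *v y') p)) q.
Hypothesis A_monotone : monotone_on.

Implicit Types (U V : I -> 'I_r -> R).

(** The difference of two solutions solves the homogeneous equation; pairing it with itself and
    using monotonicity forces it to vanish. *)
Lemma als_K_unique U V (s : 'I_r * 'I_r -> R^o) (k k' : I * 'I_r -> R^o) :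
  als_K domA A f h U V s k -> als_K domA A f h U V s k' -> k = k'.
Proof.
move=> [[dk _ Bk _] Ek] [[dk' _ Bk' _] Ek'].
have [q q0 qs] := A_monotone dk dk'.
have H := @orthonormal_monotone_eq0 _ _ _ V I h q
  (fun j m => k (j, m) - k' (j, m)).
apply/funext => -[j m]; apply/eqP; rewrite -subr_eq0; apply/eqP; move: j m.
pose w p := (A *v (V \ox idmat) *v k) p - (A *v (V \ox idmat) *v k') p.
apply: (H w h_gt0 q0) => [|j m].
  apply: eq_has_sum qs => p; rewrite !mulmv_kron_idr -sumrB; congr (_ * _).
  by apply: eq_bigr => m _; rewrite mulrBr.
have hk := mulmv_cvg_has_sum Bk (j, m); have hk' := mulmv_cvg_has_sum Bk' (j, m).
eexists.
  move/has_sum_kron_idr : hk => /= hk; move/has_sum_kron_idr : hk' => /= hk'.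
  by apply: eq_has_sum (has_sumB hk hk') => i; rewrite /trmat mulrBr.
exact: (implicit_step_sub Ek Ek').
Qed.

Lemma als_L_unique U U1 V (s : 'I_r * 'I_r -> R^o) (l l' : 'I_r * I -> R^o) :
  als_L domA A f h U U1 V s l -> als_L domA A f h U U1 V s l' -> l = l'.
Proof.
move=> [[dl _ Bl _] El] [[dl' _ Bl' _] El'].
have [q q0 qs] := A_monotone dl dl'.
have H := @orthonormal_monotone_eq0 _ _ _ U1 I h q
  (fun j m => l (m, j) - l' (m, j)).
apply/funext => -[m j]; apply/eqP; rewrite -subr_eq0; apply/eqP; move: j m.
(* The pair is swapped because U1 acts on the first index, while [orthonormal_monotone_eq0]
   contracts the second. *)
pose w p := (A *v (idmat \ox U1) *v l) (p.2, p.1) -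
  (A *v (idmat \ox U1) *v l') (p.2, p.1).
apply: (H w h_gt0 q0) => [|j m].
  move/has_sum_swap : qs; apply: eq_has_sum => p /=.
  rewrite !mulmv_kron_idl -sumrB/=; congr (_ * _).
  by apply: eq_bigr => m _; rewrite mulrBr.
have hl := mulmv_cvg_has_sum Bl (m, j); have hl' := mulmv_cvg_has_sum Bl' (m, j).
eexists.
  move/has_sum_kron_idl : hl => /= hl; move/has_sum_kron_idl : hl' => /= hl'.
  by apply: eq_has_sum (has_sumB hl hl') => i; rewrite /trmat mulrBr.
exact: (implicit_step_sub El El').
Qed.

(** For a fixed first index the splitting equation lies in the column span of V, with U s as initial
    coefficients. Cancelling V leaves the ALS equation together with the convergence of its
    series. *)
Lemma splitting_K_als U V (s : 'I_r * 'I_r -> R^o) (k : I * 'I_r -> R^o) :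
  orthonormal_columns V ->
  splitting_K domA A f h U V s k -> als_K domA A f h U V s k.
Proof.
rewrite /splitting_K mulmm_trmat => oV [[dk Ak Bk Bf] E].
have H : forall p : I * 'I_r, exists s' t, [/\
    has_sum (fun i => V i p.2 * (A *v (V \ox idmat) *v k) (p.1, i)) s',
    has_sum (fun i => V i p.2 * f (p.1, i)) t &
    k p + h * s' = \sum_l U p.1 l * s (l, p.2) + h * t].
  move=> [j m]; apply: (@orthonormal_projection_eq _ _ _ V oV h
    (fun i => (A *v (V \ox idmat) *v k) (j, i)) (fun i => f (j, i))
    (fun m => k (j, m)) (fun m => \sum_l U j l * s (l, m))) => i.
  have /has_sum_kron_idr hk := mulmv_cvg_has_sum Bk (j, i).
  have /has_sum_kron_idr hf := mulmv_cvg_has_sum Bf (j, i).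
  do 2 eexists; split.
  - exact hk.
  - exact hf.
  move/implicit_stepE/(_ (j, i)) : E.
  rewrite mulmv_kron_idr/= => ->; congr (_ + _).
  rewrite mulmv_kron exchange_big/=; apply: eq_bigr => n _.
  by rewrite mulr_sumr; apply: eq_bigr => l _; ring.
split.
  split=> // p; have [a [b [ha hb _]]] := H p; [exists a|exists b];
  exact/has_sum_kron_idr.
apply/implicit_stepE => p; have [a [b [ha hb e]]] := H p.
rewrite (mulmv_has_sum (iffRL (has_sum_kron_idr (trmat V) _ p a) ha)).
by rewrite (mulmv_has_sum (iffRL (has_sum_kron_idr (trmat V) _ p b) hb))
  mulmv_kron_idl.
Qed.

(** As for the K step, with U1 cancelled for a fixed second index. The formula for [s0p] then turns
    the initial term into that of ALS. *)
Lemma splitting_L_als U U1 V (s s0p : 'I_r * 'I_r -> R^o)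
    (l : 'I_r * I -> R^o) :
  orthonormal_columns U1 ->
  (forall p, s0p p = \sum_m mulmm (trmat U1) U p.1 m * s (m, p.2)) ->
  splitting_L domA A f h U1 V s0p l -> als_L domA A f h U U1 V s l.
Proof.
rewrite /splitting_L mulmm_trmat => oU sE [[dk Ak Bk Bf] E].
have H : forall p : 'I_r * I, exists s' t, [/\
    has_sum (fun i => U1 i p.1 * (A *v (idmat \ox U1) *v l) (i, p.2)) s',
    has_sum (fun i => U1 i p.1 * f (i, p.2)) t &
    l p + h * s' = \sum_n V p.2 n * s0p (p.1, n) + h * t].
  move=> [m j]; apply: (@orthonormal_projection_eq _ _ _ U1 oU h
    (fun i => (A *v (idmat \ox U1) *v l) (i, j)) (fun i => f (i, j))
    (fun m => l (m, j)) (fun m => \sum_n V j n * s0p (m, n))) => i.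
  have /has_sum_kron_idl hk := mulmv_cvg_has_sum Bk (i, j).
  have /has_sum_kron_idl hf := mulmv_cvg_has_sum Bf (i, j).
  do 2 eexists; split.
  - exact hk.
  - exact hf.
  move/implicit_stepE/(_ (i, j)) : E.
  rewrite mulmv_kron_idl/= => ->; congr (_ + _).
  rewrite mulmv_kron/=; apply: eq_bigr => n _.
  by rewrite mulr_sumr; apply: eq_bigr => n' _; ring.
split.
  split=> // p; have [a [b [ha hb _]]] := H p; [exists a|exists b];
  exact/has_sum_kron_idl.
apply/implicit_stepE => p; have [a [b [ha hb e]]] := H p.
rewrite (mulmv_has_sum (iffRL (has_sum_kron_idl (trmat U1) _ p a) ha)).
rewrite (mulmv_has_sum (iffRL (has_sum_kron_idl (trmat U1) _ p b) hb)).
rewrite e mulmv_kron exchange_big/=; congr (_ + _); apply: eq_bigr => n _.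
by rewrite sE mulr_sumr; apply: eq_bigr => m _ /=; ring.
Qed.

(** Multiplying the K equation by U1^T sends k to [s1p], so its right-hand side U s becomes U1^T U
    s. Solved for that term, the result is the backward step. *)
Lemma splitting_S_projection U U1 V (s s1p s0p : 'I_r * 'I_r -> R^o)
    (k : I * 'I_r -> R^o) :
  orthonormal_columns U -> orthonormal_columns U1 ->
  als_K domA A f h U V s k -> k = (idmat \ox U1) *v s1p ->
  splitting_S domA A f h U1 V s1p s0p ->
  forall p, s0p p = \sum_m mulmm (trmat U1) U p.1 m * s (m, p.2).
Proof.
move=> oU oU1 [[_ _ Bk Bf] Ek] kE [[_ _ Sk Sf] ->] [a b].
(* The S step and the K step apply A to the same vector. *)
have yE : (V \ox U1) *v s1p = (V \ox idmat) *v k.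
  apply/funext => p; rewrite mulmv_kron mulmv_kron_idr exchange_big/=.
  apply: eq_bigr => m _; rewrite kE mulmv_kron_idl mulr_sumr.
  by apply: eq_bigr => l _ /=; ring.
rewrite yE in Sk *; set w := A *v _ in Bk Ek Sk *.
(* Fubini: contracting both indices at once equals contracting first with V, then with U1. *)
have iter (g : I * I -> R^o) : mulmv_cvg (V^T \ox U1^T) g ->
    mulmv_cvg (V^T \ox idmat) g ->
    has_sum (fun i => U1 i a * ((V^T \ox idmat) *v g) (i, b))
      (((V^T \ox U1^T) *v g) (a, b)).
  move=> /mulmv_cvg_has_sum/(_ (a, b)) gs /mulmv_cvg_has_sum gt.
  apply: has_sum_fubini gs _ => i /=.
  have /has_sum_kron_idr/(has_sumZ (c := U1 i a)) := gt (i, b).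
  by apply: eq_has_sum => j /=; rewrite /kron /trmat/= mulrA.
have hw := has_sumZ (c := h) (iter _ Sk Bk).
have hf := has_sumZ (c := h) (iter _ Sf Bf).
have hk := @orthonormal_columns_coef _ _ _ U1 oU1 (fun m => s1p (m, b)) a.
have hs : has_sum (fun i => \sum_m s (m, b) * (U1 i a * U i m))
    (\sum_m s (m, b) * mulmm (trmat U1) U a m).
  have H m := has_sumZ (c := s (m, b)) (@mulmm_has_sum _ _ _ U1 U a m oU1 oU).
  exact: (has_sum_bigop (r := index_enum 'I_r) H).
have scale_step (u x y c d : R) :
    x + h * c = y + h * d -> u * x + h * (u * c) - h * (u * d) = u * y.
  by move=> E; rewrite (_ : x = y + h * d - h * c); [ring|rewrite -E addrK].
(* The family with sum U1^T U s is summed a second time, termwise through the K equation; uniqueness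
   of sums equates the two values. *)
have hl : has_sum (fun i => \sum_m s (m, b) * (U1 i a * U i m))
    (s1p (a, b) + h * ((V^T \ox U1^T) *v w) (a, b) -
     h * ((V^T \ox U1^T) *v f) (a, b)).
  apply: eq_has_sum (has_sumB (has_sumD hk hw) hf) => i.
  move/implicit_stepE/(_ (i, b)) : Ek; rewrite kE !mulmv_kron_idl/= => E.
  have -> : \sum_m s (m, b) * (U1 i a * U i m) =
      U1 i a * \sum_m U i m * s (m, b).
    by rewrite mulr_sumr; apply: eq_bigr => m _; ring.
  exact: (scale_step _ _ _ _ _ E).
transitivity (\sum_m s (m, b) * mulmm (trmat U1) U a m); last first.
  by apply: eq_bigr => m _; rewrite mulrC.
by rewrite -(has_sum_unique hl hs).
Qed.

Theorem splitting_als factU factV U0 V0 (s0 : 'I_r * 'I_r -> R^o)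
    (u1 y1 : I * I -> R^o) :
  orthonormal_columns U0 -> orthonormal_columns V0 ->
  splitting_step domA A f h factU factV U0 V0 s0 u1 ->
  als_step domA A f h factU factV U0 V0 s0 y1 -> u1 = y1.
Proof.
move=> oU oV [k [U1 [s1p [s0p [l [V1 [s1 [[sK [fU kE oU1]] sS [sL [fV _ _]] ->]]]]]]]].
move=> [k' [U1' [s1p' [l' [V1' [s1' [[aK [fU' _ _]] [aL [fV' _ _]] ->]]]]]]].
have aK' := splitting_K_als oV sK.
(* Equal k give equal factors since both schemes call the same function [factU]; likewise below for
   l and [factV]. *)
have kk := als_K_unique aK aK'; rewrite kk fU in fU'.
case: fU' => ? ?; subst U1' s1p'.
have aL' := splitting_L_als oU1 (splitting_S_projection oU oU1 aK' kE sS) sL.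
have ll := als_L_unique aL aL'; rewrite ll fV in fV'.
by case: fV' => -> ->.
Qed.

End Schemes.

(** * Monotonicity of the stiffness matrix *)

Section SquareIntegrable.
Context {R : realType} {d : measure_display} {T : measurableType d}.
Context (mu : {measure set T -> \bar R}) (D : set T).
Hypothesis mD : measurable D.
Implicit Types f g : T -> R.

Local Notation sqi := (square_integrable mu D).
Local Notation "'<[ f , g ]>" := (\int[mu]_(x in D) (f x * g x)).

Lemma integrable_EFinD f g : mu.-integrable D (EFin \o f) ->
  mu.-integrable D (EFin \o g) -> mu.-integrable D (EFin \o (fun x => f x + g x)).
Proof.
move=> iF ig; have := integrableD mD iF ig; exact: eq_integrable.
Qed.

Lemma integrable_EFinZ c f : mu.-integrable D (EFin \o f) ->
  mu.-integrable D (EFin \o (fun x => c * f x)).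
Proof.
move=> iF; have := integrableZl mD c iF; exact: eq_integrable.
Qed.

Lemma integrable_Rintegral_sum (J : Type) (r : seq J) (F : J -> T -> R) :
  (forall j, mu.-integrable D (EFin \o F j)) ->
  mu.-integrable D (EFin \o (fun x => \sum_(j <- r) F j x)) /\
  \int[mu]_(x in D) (\sum_(j <- r) F j x) = \sum_(j <- r) \int[mu]_(x in D) F j x.
Proof.
move=> iF; elim: r => [|j r [ir er]].
  have -> : (fun x => \sum_(j <- [::]) F j x) = (fun=> 0).
    by apply/funext => x; rewrite big_nil.
  by rewrite big_nil Rintegral_cst// mul0r; split=> //; exact: integrable0.
have -> : (fun x => \sum_(i <- j :: r) F i x) =
    (fun x => F j x + \sum_(i <- r) F i x).
  by apply/funext => x; rewrite big_cons.
rewrite big_cons -er; split; first exact: integrable_EFinD.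
exact: RintegralD.
Qed.

Lemma square_integrable_sqr f : sqi f -> mu.-integrable D (EFin \o (fun x => f x ^+ 2)).
Proof.
move=> [mf f2]; apply/integrableP; split.
  exact/measurable_EFinP/measurable_funX.
under eq_integral do rewrite /= ger0_norm ?sqr_ge0//.
exact: f2.
Qed.

Lemma square_integrable_le f g : measurable_fun D f ->
  mu.-integrable D (EFin \o g) -> (forall x, f x ^+ 2 <= g x) -> sqi f.
Proof.
move=> mf ig fg; split=> //.
have : mu.-integrable D (EFin \o (fun x => f x ^+ 2)).
  apply: le_integrable ig => //; first exact/measurable_EFinP/measurable_funX.
  move=> x _ /=; rewrite lee_fin ger0_norm ?sqr_ge0//.
  exact: le_trans (fg x) (ler_norm _).
move=> /integrableP[_]; apply: le_lt_trans; apply: ge0_le_integral => //.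
- by move=> x _; rewrite lee_fin sqr_ge0.
- exact/measurable_EFinP/measurable_funX.
- by do 2 apply: measurableT_comp => //; exact: measurable_funX.
- by move=> x _ /=; rewrite lee_fin ler_norm.
Qed.

Lemma square_integrableD f g : sqi f -> sqi g -> sqi (f \+ g).
Proof.
move=> sf sg; have [[mf _] [mg _]] := (sf, sg).
apply: (@square_integrable_le _ (fun x => 2 * f x ^+ 2 + 2 * g x ^+ 2)).
- exact: measurable_funD.
- by apply: integrable_EFinD; apply: integrable_EFinZ; exact: square_integrable_sqr.
- by move=> x /=; have := sqr_ge0 (f x - g x); rewrite sqrrB sqrrD; lra.
Qed.

Lemma square_integrableZ c f : sqi f -> sqi (fun x => c * f x).
Proof.
move=> sf; have [mf _] := sf.
apply: (@square_integrable_le _ (fun x => c ^+ 2 * f x ^+ 2)).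
- exact: measurable_funM.
- by apply: integrable_EFinZ; exact: square_integrable_sqr.
- by move=> x; rewrite exprMn.
Qed.

Lemma square_integrable0 : sqi (fun=> 0).
Proof.
by split=> //; rewrite integral0_eq// => x _; rewrite expr0n.
Qed.

Lemma square_integrable_mul f g : sqi f -> sqi g ->
  mu.-integrable D (EFin \o (fun x => f x * g x)).
Proof.
move=> sf sg; have [[mf _] [mg _]] := (sf, sg).
apply: (le_integrable mD (g := EFin \o (fun x => f x ^+ 2 + g x ^+ 2))).
- exact/measurable_EFinP/measurable_funM.
- move=> x _ /=; rewrite lee_fin normrM [leRHS]ger0_norm ?addr_ge0 ?sqr_ge0//.
  have := sqr_ge0 (`|f x| - `|g x|); rewrite sqrrB !real_normK ?num_real//.
  by have := sqr_ge0 (f x); have := sqr_ge0 (g x); lra.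
- by apply: integrable_EFinD; exact: square_integrable_sqr.
Qed.

Lemma Rintegral_mulDl f f' g : sqi f -> sqi f' -> sqi g ->
  '<[f \+ f', g]> = '<[f, g]> + '<[f', g]>.
Proof.
move=> sf sf' sg; under eq_Rintegral do rewrite /= mulrDl.
by rewrite RintegralD//; exact: square_integrable_mul.
Qed.

Lemma Rintegral_mulZl c f g : sqi f -> sqi g ->
  '<[fun x => c * f x, g]> = c * '<[f, g]>.
Proof.
move=> sf sg; under eq_Rintegral do rewrite -mulrA.
by rewrite RintegralZl//; exact: square_integrable_mul.
Qed.

Lemma Rintegral_mulC f g : '<[f, g]> = '<[g, f]>.
Proof. by apply: eq_Rintegral => x _; rewrite mulrC. Qed.

(** Integrates the pointwise bound that follows from (t|f| - |g|)^2 >= 0. The free weight [t] lets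
    it serve in place of the Cauchy-Schwarz inequality in limits. *)
Lemma Rintegral_young f g (t : R) : sqi f -> sqi g -> 0 < t ->
  `|'<[f, g]>| <= t * '<[f, f]> + t^-1 * '<[g, g]>.
Proof.
move=> sf sg t0; have ifg := square_integrable_mul sf sg.
have iff := square_integrable_mul sf sf; have igg := square_integrable_mul sg sg.
rewrite -RintegralZl// -[in leRHS]RintegralZl// -RintegralD//; last 2 first.
- exact: integrable_EFinZ.
- exact: integrable_EFinZ.
apply: le_trans (le_normr_Rintegral mD ifg) _; apply: le_Rintegral => //.
- exact: integrable_norm.
- by apply: integrable_EFinD => //; exact: integrable_EFinZ.
move=> x _; have := sqr_ge0 (t * `|f x| - `|g x|).
rewrite sqrrB exprMn !real_normK ?num_real// normrM => H.
rewrite -(ler_pM2l t0) mulrDr mulVKf ?gt_eqF//.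
have -> : t * (t * (f x * f x)) = t ^+ 2 * f x ^+ 2 by ring.
(* The square yields 2t|fg|; nonnegativity of t|fg| allows one copy to be dropped. *)
have := mulr_ge0 (ltW t0) (mulr_ge0 (normr_ge0 (f x)) (normr_ge0 (g x))).
by move: H; rewrite -mulrA -[g x * g x]expr2; lra.
Qed.

End SquareIntegrable.

(** * Bilinearity, positivity and continuity of the elliptic form *)

Section EllipticForm.
Context {R : realType}.
Implicit Types (al : 'M[R]_2) (u v w : (R * R -> R^o) * ('I_2 -> R * R -> R^o)).

Local Notation mu := (plane_measure R).
Local Notation Om := (unit_square R).
Local Notation sqi := (square_integrable mu Om).

(** The form sees only the gradient; its components must be in L^2 for the real-valued integrals to
    be additive. *)
Definition finite_energy u : Prop := forall i, sqi (u.2 i).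

Lemma measurable_unit_square :
  measurable (Om : set (measurableTypeR R * measurableTypeR R)).
Proof. by apply: measurableX; exact: measurable_itv. Qed.
#[local] Hint Resolve measurable_unit_square : core.

Lemma finite_energyD u v : finite_energy u -> finite_energy v -> finite_energy (u + v).
Proof. by move=> eu ev i; exact: square_integrableD (eu i) (ev i). Qed.

Lemma finite_energyZ c u : finite_energy u -> finite_energy (c *: u).
Proof. by move=> eu i; exact: square_integrableZ (eu i). Qed.

Lemma finite_energyB u v : finite_energy u -> finite_energy v -> finite_energy (u - v).
Proof.
by move=> eu ev; rewrite -scaleN1r; apply: finite_energyD => //; exact: finite_energyZ.
Qed.

Lemma finite_energy_sum (J : Type) (r : seq J) (F : J -> _) :
  (forall j, finite_energy (F j)) -> finite_energy (\sum_(j <- r) F j).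
Proof.
move=> eF; elim: r => [|j r ih].
  by rewrite big_nil => i; exact: square_integrable0.
by rewrite big_cons; exact: finite_energyD.
Qed.

Lemma elliptic_formDl al u v w : finite_energy u -> finite_energy v ->
  finite_energy w ->
  elliptic_form al (u + v) w = elliptic_form al u w + elliptic_form al v w.
Proof.
move=> eu ev ew; rewrite /elliptic_form -big_split/=; apply: eq_bigr => i _.
rewrite -big_split/=; apply: eq_bigr => j _; rewrite -mulrDr; congr (_ * _).
exact: (Rintegral_mulDl measurable_unit_square (eu i) (ev i) (ew j)).
Qed.

Lemma elliptic_formZl al c u w : finite_energy u -> finite_energy w ->
  elliptic_form al (c *: u) w = c * elliptic_form al u w.
Proof.
move=> eu ew; rewrite /elliptic_form mulr_sumr; apply: eq_bigr => i _.
rewrite mulr_sumr; apply: eq_bigr => j _; rewrite mulrCA; congr (_ * _).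
exact: (Rintegral_mulZl measurable_unit_square c (eu i) (ew j)).
Qed.

(** Carries statements about the first argument over to the second. *)
Lemma elliptic_form_tr al u v : elliptic_form al u v = elliptic_form al^T v u.
Proof.
rewrite /elliptic_form exchange_big/=; apply: eq_bigr => j _.
apply: eq_bigr => i _; rewrite mxE; congr (_ * _).
exact: Rintegral_mulC.
Qed.

Lemma elliptic_formBl al u v w : finite_energy u -> finite_energy v ->
  finite_energy w ->
  elliptic_form al (u - v) w = elliptic_form al u w - elliptic_form al v w.
Proof.
move=> eu ev ew; rewrite -scaleN1r elliptic_formDl//; last exact: finite_energyZ.
by rewrite elliptic_formZl// mulN1r.
Qed.

Lemma elliptic_formBr al u v w : finite_energy u -> finite_energy v ->
  finite_energy w ->
  elliptic_form al w (u - v) = elliptic_form al w u - elliptic_form al w v.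
Proof. by move=> *; rewrite !(elliptic_form_tr _ w) elliptic_formBl. Qed.

Lemma elliptic_form_suml al (J : Type) (r : seq J) (c : J -> R) (F : J -> _) w :
  (forall j, finite_energy (F j)) -> finite_energy w ->
  elliptic_form al (\sum_(j <- r) c j *: F j) w =
  \sum_(j <- r) c j * elliptic_form al (F j) w.
Proof.
move=> eF ew; have ecF j : finite_energy (c j *: F j) by exact: finite_energyZ.
elim: r => [|j r ih]; last first.
  by rewrite !big_cons elliptic_formDl// ?ih ?elliptic_formZl//;
    exact: finite_energy_sum.
rewrite !big_nil -(scale0r w) elliptic_formZl ?mul0r//.
Qed.

Lemma elliptic_form_ge0 al u :
  (forall xi : 'cV[R]_2, 0 <= (xi^T *m al *m xi) 0 0) -> finite_energy u ->
  0 <= elliptic_form al u u.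
Proof.
move=> al0 eu; have iu i j c : mu.-integrable Om
    (EFin \o (fun x => c * (u.2 i x * u.2 j x))).
  by apply: integrable_EFinZ => //; exact: square_integrable_mul (eu i) (eu j).
have iu' i j : mu.-integrable Om (EFin \o (fun x => u.2 i x * u.2 j x)).
  exact: square_integrable_mul (eu i) (eu j).
have isum i := integrable_Rintegral_sum measurable_unit_square
  (index_enum 'I_2) (fun j => iu i j (al i j)).
have [_] := integrable_Rintegral_sum measurable_unit_square
  (index_enum 'I_2) (fun i => (isum i).1).
under eq_bigr do rewrite (isum _).2.
rewrite /elliptic_form => E.
under eq_bigr do under eq_bigr do
  rewrite -(RintegralZl _ measurable_unit_square (iu' _ _)).
(* With the sums inside the integral, the integrand at x is the quadratic form of [al] at the
   gradient of u. *)
rewrite -E; apply: Rintegral_ge0 => x _; have := al0 (\col_i u.2 i x).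
rewrite mxE; under eq_bigr do rewrite !mxE mulr_suml.
rewrite exchange_big/=; congr (_ <= _).
apply: eq_bigr => i _; apply: eq_bigr => j _; rewrite !mxE; ring.
Qed.

Lemma cvg_Rintegral_mul (S : Type) (G : set_system S) {FG : Filter G}
    (f : S -> R * R -> R) (g : R * R -> R) :
  (forall t, sqi (f t)) -> sqi g ->
  \int[mu]_(x in Om) (f t x * f t x) @[t --> G] --> (0 : R) ->
  \int[mu]_(x in Om) (f t x * g x) @[t --> G] --> (0 : R).
Proof.
move=> sf sg /cvgr0Pnorm_lt f0; apply/cvgr0Pnorm_lt => e e0.
have [c cE] : exists c, \int[mu]_(x in Om) (g x * g x) = c by eexists.
have c0 : 0 <= c by rewrite -cE; apply: Rintegral_ge0 => x _; rewrite -expr2 sqr_ge0.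
(* Chosen so that c / t < e / 2; the added 1 keeps [t] positive when c = 0. The other half of e
   comes from the smallness of the squared norm of [f]. *)
pose t := 2 * (c + 1) / e.
have t0 : 0 < t by rewrite divr_gt0// mulr_gt0//; lra.
have ct : t^-1 * c < e / 2.
  have tE : t * (e / 2) = c + 1 by rewrite /t; field; rewrite gt_eqF.
  by rewrite ltr_pdivrMl// tE ltrDl.
have := f0 (t^-1 * (e / 2)).
have -> : 0 < t^-1 * (e / 2) by rewrite mulr_gt0 ?invr_gt0//; lra.
move=> /(_ isT); apply: filterS => s hs.
apply: le_lt_trans (Rintegral_young measurable_unit_square (sf s) sg t0) _.
rewrite cE; move/(le_lt_trans (ler_norm _)) : hs.
by rewrite ltr_pdivlMl//; lra.
Qed.

(** The H^1 norms of the differences are eventually finite and dominate each gradient component in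
    L^2, so every pairing with a component of v converges. *)
Lemma cvg_elliptic_form al (S : Type) (G : set_system S) {FG : Filter G}
    (f : S -> (R * R -> R^o) * ('I_2 -> R * R -> R^o)) u v :
  (forall t, finite_energy (f t)) -> finite_energy u -> finite_energy v ->
  H1norm2 mu Om (f t - u) @[t --> G] --> 0%E ->
  elliptic_form al (f t) v @[t --> G] --> elliptic_form al u v.
Proof.
move=> ef eu ev /fine_cvgP[finN N0].
have efu t : finite_energy (f t - u) by exact: finite_energyB.
have grad0 i : \int[mu]_(x in Om) ((f t - u).2 i x * (f t - u).2 i x)
    @[t --> G] --> (0 : R).
  apply: (squeeze_cvgr _ (cvg_cst 0) N0).
  near=> t; apply/andP; split.
    by apply: Rintegral_ge0 => x _; rewrite -expr2 sqr_ge0.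
  rewrite /= /Rintegral.
  have fint : H1norm2 mu Om (f t - u) \is a fin_num by near: t.
  apply: fine_le => //.
    exact: integrable_fin_num (square_integrable_mul _ (efu t i) (efu t i)).
  rewrite /H1norm2 (bigD1 i)//= addeCA.
  apply: leeDl.
  apply: adde_ge0; first by apply: integral_ge0 => x _; rewrite lee_fin sqr_ge0.
  by apply: sume_ge0 => j _; apply: integral_ge0 => x _; rewrite lee_fin sqr_ge0.
have : elliptic_form al (f t - u) v @[t --> G] --> (0 : R).
  have -> : (0 : R) = \sum_(i < 2) \sum_(j < 2) al i j * 0.
    by rewrite big1// => i _; rewrite big1// => j _; rewrite mulr0.
  apply: cvg_big => [|i _]; first exact: add_continuous.
  apply: cvg_big => [|j _]; first exact: add_continuous.
  apply: cvgM; first exact: cvg_cst.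
  by apply: (@cvg_Rintegral_mul _ _ _ (fun t => (f t - u).2 i)) => // t; exact: efu.
under eq_fun do rewrite elliptic_formBl//.
move=> /(cvgD (cvg_cst (elliptic_form al u v))); rewrite addr0.
suff -> : (fun t => elliptic_form al (f t) v) =
  cst (elliptic_form al u v) \+
    (fun t => elliptic_form al (f t) v - elliptic_form al u v) by [].
by apply/funext => t /=; rewrite addrC subrK.
Unshelve. all: by end_near.
Qed.

End EllipticForm.

(** * Tensor products of univariate functions *)

Section Tensor.
Context {R : realType}.

Local Notation leb := (@lebesgue_measure R).
Local Notation mu := (plane_measure R).
Local Notation itv := (unit_itv R).
Local Notation Om := (unit_square R).

(** By Tonelli the integral of the square factors into two univariate integrals. *)
Lemma square_integrable_tensor (p q : R -> R) :
  square_integrable leb itv p -> square_integrable leb itv q ->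
  square_integrable mu Om (fun x => p x.1 * q x.2).
Proof.
move=> [mp p2] [mq q2].
have mI : measurable (itv : set (measurableTypeR R)) by exact: measurable_itv.
(* Extension by zero gives functions measurable on the whole line, so Tonelli applies on the full
   plane. *)
pose P := p \_ itv; pose Q := q \_ itv.
have mP : measurable_fun setT P by exact: (measurable_restrictT p mI).1.
have mQ : measurable_fun setT Q by exact: (measurable_restrictT q mI).1.
have PQE : (fun x : R * R => P x.1 * Q x.2) = (fun x => p x.1 * q x.2) \_ Om.
  apply/funext => -[x y]; rewrite /P /Q /patch /= in_setX.
  by case: ifP => //= _; case: ifP => //= _; rewrite ?(mulr0, mul0r).
have mPQ : measurable_fun setT (fun x : R * R => P x.1 * Q x.2).
  by apply: measurable_funM; apply: measurableT_comp.
split.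
  by apply: (measurable_restrictT _ measurable_unit_square).2; rewrite -PQE.
have sqr_restrict (f : R -> R) :
    (\int[leb]_(x in itv) (f x ^+ 2)%:E = \int[leb]_x ((f \_ itv) x ^+ 2)%:E)%E.
  rewrite [LHS]integral_mkcond; apply: eq_integral => x _.
  by rewrite /patch; case: ifP => // _; rewrite expr0n.
have sqrE : (fun x : R * R => ((p x.1 * q x.2) ^+ 2)%:E) \_ Om =
    (fun x => ((P x.1 * Q x.2) ^+ 2)%:E).
  apply/funext => x; rewrite [P _ * _](congr1 (fun f => f x) PQE) /patch.
  by case: ifP => // _; rewrite expr0n.
rewrite integral_mkcond sqrE.
rewrite sqr_restrict -/P in p2; rewrite sqr_restrict -/Q in q2.
rewrite /plane_measure fubini_tonelli1/=; last 2 first.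
- exact/measurable_EFinP/measurable_funX.
- by move=> x; rewrite lee_fin sqr_ge0.
rewrite /fubini_F/=.
have Q0 : (0 <= \int[leb]_y (Q y ^+ 2)%:E)%E.
  by apply: integral_ge0 => y _; rewrite lee_fin sqr_ge0.
under eq_integral => x _.
  under eq_integral => y _ do rewrite exprMn EFinM.
  rewrite ge0_integralZl_EFin ?sqr_ge0//; last 2 first.
  - by move=> y _; rewrite lee_fin sqr_ge0.
  - exact/measurable_EFinP/measurable_funX.
  over.
rewrite ge0_integralZr//.
- have P0 : (0 <= \int[leb]_x (P x ^+ 2)%:E)%E.
    by apply: integral_ge0 => y _; rewrite lee_fin sqr_ge0.
  by apply: lte_mul_pinfty => //; rewrite ge0_fin_numE.
- exact/measurable_EFinP/measurable_funX.
- by move=> x _; rewrite lee_fin sqr_ge0.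
Qed.

Lemma H10_square_finite_energy (u : sobolev R (R * R) 2) :
  H10_square u -> finite_energy u.
Proof. by case. Qed.

(** Each partial derivative of a tensor product is again one, of a function and a derivative that
    are both in L^2. *)
Lemma finite_energy_product_basis (I : choiceType) (phi : I -> sobolev R R 1) i :
  (forall n, H10_itv (phi n)) -> finite_energy (product_basis phi i).
Proof.
move=> reg; have [s1 d1 _] := reg i.1; have [s2 d2 _] := reg i.2.
move=> k; rewrite /product_basis /tensor/=.
by case: (k == 0); exact: square_integrable_tensor.
Qed.

End Tensor.

(** * Basis expansions and monotonicity *)

Section StiffnessMonotone.
Context {R : realType} {I : choiceType} (phi : I -> sobolev R R 1).
Hypothesis phi_regular : forall n, H10_itv (phi n).
Context (al : 'M[R]_2).
Hypothesis al_ge0 : forall xi : 'cV[R]_2, 0 <= (xi^T *m al *m xi) 0 0.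

Local Notation psi := (product_basis phi).
Local Notation expands y u := (H1norm2 (plane_measure R) (unit_square R)
   (summability.partial_sum (fun i => y i *: psi i) F - u)
   @[F --> summability.totally] --> 0%E).

(** Linearity on finite partial sums, then continuity in H^1. The matrix [be] is free since both
    [al] and its transpose are substituted. *)
Lemma has_sum_elliptic_form (be : 'M[R]_2) (y : I * I -> R^o) u v :
  finite_energy u -> finite_energy v -> expands y u ->
  has_sum (fun i => y i * elliptic_form be (psi i) v) (elliptic_form be u v).
Proof.
move=> eu ev yu.
have epsi i := finite_energy_product_basis i phi_regular.
have eF (F : {fset I * I}) :
    finite_energy (summability.partial_sum (fun i => y i *: psi i) F).
  by rewrite partial_sumE; apply: finite_energy_sum => i; exact: finite_energyZ.
suff E : summability.partial_sum (fun i => y i * elliptic_form be (psi i) v) =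
    (fun F : {fset I * I} =>
    elliptic_form be (summability.partial_sum (fun i => y i *: psi i) F) v).
  by rewrite /has_sum E; exact: (cvg_elliptic_form (al := be) eF eu ev yu).
by apply/funext => F; rewrite !partial_sumE elliptic_form_suml.
Qed.

Lemma stiffness_monotone : monotone_on (energy_domain phi) (stiffness phi al).
Proof.
move=> y y' [u [/H10_square_finite_energy eu yu]].
move=> [u' [/H10_square_finite_energy eu' yu']].
have epsi i := finite_energy_product_basis i phi_regular.
(* The stiffness matrix applied to the coefficients of w tests the form at w against the basis. *)
have AE z w : finite_energy w -> expands z w ->
    forall i, mulmv (stiffness phi al) z i = elliptic_form al w (psi i).
  move=> ew zw i; apply: has_sum_sum.
  have := has_sum_elliptic_form (be := al) ew (epsi i) zw.
  by apply: eq_has_sum => j; rewrite mulrC.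
have euu := finite_energyB eu eu'.
exists (elliptic_form al (u - u') (u - u')); first exact: elliptic_form_ge0.
(* Expansion in the second argument, obtained from the first by transposing [al]. *)
have S z w : finite_energy w -> expands z w ->
    has_sum (fun i => z i * elliptic_form al (u - u') (psi i))
      (elliptic_form al (u - u') w).
  move=> ew zw; rewrite elliptic_form_tr.
  apply: eq_has_sum (has_sum_elliptic_form (be := al^T) ew euu zw) => i.
  by rewrite -elliptic_form_tr.
rewrite [X in has_sum _ X]elliptic_formBr//.
apply: eq_has_sum (has_sumB (S _ _ eu yu) (S _ _ eu' yu')) => i.
by rewrite (AE _ _ eu yu) (AE _ _ eu' yu') -elliptic_formBl// mulrBl.
Qed.

End StiffnessMonotone.

Lemma uniformly_posdef_ge0 (R : realType) (times : set R) (alpha : R -> 'M[R]_2) t :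
  uniformly_posdef_coef times alpha -> times t ->
  forall xi : 'cV[R]_2, 0 <= (xi^T *m alpha t *m xi) 0 0.
Proof.
move=> [c c0 posdef] tt xi; apply: le_trans (posdef t xi tt).
rewrite mulr_ge0 ?(ltW c0)// mxE; apply: sumr_ge0 => i _.
by rewrite mxE -expr2 sqr_ge0.
Qed.

Theorem proposition5p1 (R : realType)
  (times : set R) (alpha : R -> 'M[R]_2)
  (alpha_sym : symmetric_coef times alpha)
  (alpha_bounded : uniformly_bounded_coef times alpha)
  (alpha_posdef : uniformly_posdef_coef times alpha)
  (f : R -> sobolev R (R * R) 2 -> R)
  (f_dual : forall t, times t -> Hm1_square (f t))
  (I : set nat) (phi : I -> sobolev R R 1)
  (phi_regular : forall n, H10_itv (phi n))
  (phi_orthonormal : orthonormal_system phi)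
  (t0 h : R) (h_gt0 : 0 < h) (t0_time : times t0) (t1_time : times (t0 + h))
  (r : nat)
  (factU : (I * 'I_r -> R^o) -> (I -> 'I_r -> R) * ('I_r * 'I_r -> R^o))
  (factV : ('I_r * I -> R^o) -> (I -> 'I_r -> R) * ('I_r * 'I_r -> R^o))
  (U0 V0 : I -> 'I_r -> R) (s0 : 'I_r * 'I_r -> R^o)
  (U0_orthonormal : orthonormal_columns U0)
  (V0_orthonormal : orthonormal_columns V0)
  (u1 y1 : I * I -> R^o) :
  let A1 := stiffness phi (alpha (t0 + h)) in
  let f1 := load phi (f (t0 + h)) in
  splitting_step (energy_domain phi) A1 f1 h factU factV U0 V0 s0 u1 ->
  als_step (energy_domain phi) A1 f1 h factU factV U0 V0 s0 y1 ->
  u1 = y1.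
Proof.
(* Both schemes evaluate the operator at the new time point, where positivity of [alpha] makes the
   stiffness matrix monotone. *)
move=> A1 f1; apply: splitting_als => //; apply: stiffness_monotone => //.
exact: uniformly_posdef_ge0 alpha_posdef t1_time.
Qed.
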